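(* With $\widetilde{\sigma}(\boldsymbol{X})$ the $2n\times 2n$ matrix over $\mathbb{C}[z_{i,j},\xi_{i,j},u\,;\,1\le i<j\le n]$ defined in the context (case $\mathfrak{g}=\mathfrak{so}_{2n}$), and $\gamma_k=\sum_{I\subset[n],\,|I|=2k}\operatorname{Pf}(z_I)\operatorname{Pf}(\xi_I)$, one has $$\operatorname{Pf}\bigl(\widetilde{\sigma}(\boldsymbol{X})\bigr)=\sum_{k=0}^{\lfloor n/2\rfloor}(u+\gamma_1)^{n-2k}\,\bigl(s-(u+\gamma_1)\bigr)^{k}\,\gamma_k .$$
   Context: Fix an integer $n\ge 1$ and $s\in\mathbb{Z}$; $[n]=\{1,\dots,n\}$. Let $z_{i,j},\xi_{i,j}$ ($1\le i<j\le n$) and $u$ be independent commuting indeterminates; set $z_{j,i}=-z_{i,j}$, $\xi_{j,i}=-\xi_{i,j}$, $z_{i,i}=\xi_{i,i}=0$. For $I\subset[n]$, $z_I$ and $\xi_I$ are the submatrices of the alternating matrices $(z_{i,j})$, $(\xi_{i,j})$ with row and column indices in $I$; $\operatorname{Pf}$ of the empty matrix is $1$. Thus $\gamma_0=1$ and $\gamma_1=\sum_{k<l}z_{k,l}\xi_{k,l}$. ($\gamma_k$ is the principal symbol of the $\mathrm{GL}_n$-invariant differential operator $\varGamma_k=\sum_{|I|=2k}\operatorname{Pf}(z_I)\operatorname{Pf}(\partial_I)$ on alternating matrices.) $E_{a,b}$ denotes the $2n\times 2n$ matrix units, and an index $-i$ stands for $2n+1-i$. A basis of $\mathfrak{so}_{2n}$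 (complexified Lie algebra of $\mathrm{SO}^*(2n)$) is $X^0_{i,j}=E_{i,j}-E_{-j,-i}$ ($i,j\in[n]$), $X^+_{i,j}=E_{i,-j}-E_{j,-i}$, $X^-_{i,j}=E_{-j,i}-E_{-i,j}$ ($1\le i<j\le n$). With respect to $B(X,Y)=\frac12\operatorname{tr}(XY)$ the dual basis is $(X^0_{i,j})^\vee=X^0_{j,i}$, $(X^\pm_{i,j})^\vee=X^\mp_{i,j}$. Define polynomials $$\widetilde\sigma(X^0_{i,i})=u+\sum_{k<l;\ k,l\ne i}z_{k,l}\xi_{k,l},\qquad \widetilde\sigma(X^0_{i,j})=-\sum_{k=1}^n z_{k,j}\xi_{k,i}\ (i\ne j),\qquad \widetilde\sigma(X^+_{i,j})=-\xi_{i,j},$$ $$\widetilde\sigma(X^-_{i,j})=-(u+s)z_{i,j}-\sum_{k<l;\ \{k,l\}\cap\{i,j\}=\varnothing}(z_{i,j}z_{k,l}-z_{i,k}z_{j,l}+z_{i,l}z_{j,k})\,\xi_{k,l}.$$ (These arise from the symbols, $\partial_{i,j}\mapsto\xi_{i,j}$, of the differential operators $d\pi_\lambda(X^\epsilon_{i,j})$ of the holomorphic discrete series, by rewriting those containing $s$ in terms of $\gamma_1$ and substituting $s-u$ for $\gamma_1$.) Put $$\widetilde\sigma(\boldsymbol X)=\sum_{i,j\in[n]}\widetilde\sigma(X^0_{j,i})X^0_{i,j}+\sum_{i<j}\widetilde\sigma(X^-_{i,j})X^+_{i,j}+\sum_{i<j}\widetilde\sigma(X^+_{i,j})X^-_{i,j}.$$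 Let $J_{2n}$ be the $2n\times2n$ matrix with $1$'s on the antidiagonal and $0$ elsewhere. For a $2n\times 2n$ matrix $A$ alternating along the antidiagonal (i.e. $AJ_{2n}$ is alternating; every element of $\mathfrak{so}_{2n}$ is such), $\operatorname{Pf}(A)$ means the usual Pfaffian $\operatorname{Pf}(AJ_{2n})$. *)

(* Defs.v *)
From HB Require Import structures.
From mathcomp Require Import all_boot all_order all_fingroup all_algebra.
From mathcomp Require Import reals.
From mathcomp Require Import complex.
From mathcomp Require Import mpoly.

Set Implicit Arguments.
Unset Strict Implicit.
Unset Printing Implicit Defensive.

Import Order.TTheory GRing.Theory Num.Theory.

Local Open Scope ring_scope.

Lemma even_ord_subproof m (i : 'I_m./2) : (i.*2 < m)%N.
Proof.
have h : (i.+1.*2 <= m./2.*2)%N by rewrite leq_double ltn_ord.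
apply: (leq_trans (ltnW h)); rewrite -[leqRHS]odd_double_half; exact: leq_addl.
Qed.

Lemma odd_ord_subproof m (i : 'I_m./2) : (i.*2.+1 < m)%N.
Proof.
have h : (i.+1.*2 <= m./2.*2)%N by rewrite leq_double ltn_ord.
apply: (leq_trans h); rewrite -[leqRHS]odd_double_half; exact: leq_addl.
Qed.

Definition even_ord m (i : 'I_m./2) : 'I_m := Ordinal (even_ord_subproof i).
Definition odd_ord m (i : 'I_m./2) : 'I_m := Ordinal (odd_ord_subproof i).

Section Pfaffian.

Variables (K : fieldType) (A : comAlgType K).

(* With p = m/2: Pf M = 1/(2^p p!) * sum over s in S_m of
   sgn(s) * M_{s(1),s(2)} * M_{s(3),s(4)} * ... * M_{s(m-1),s(m)}.
   This is the usual Pfaffian when M is alternating and K has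
   characteristic 0. *)
Definition Pf m (M : 'M[A]_m) : A :=
  if odd m then 0 else
  ((2 ^ m./2 * (m./2)`!)%:R : K)^-1 *:
    \sum_(s : 'S_m) (-1) ^+ s *
      \prod_(i < m./2) M (s (even_ord i)) (s (odd_ord i)).

(* [enum_val] enumerates [I] in increasing order. *)
Definition princ_submx n (I : {set 'I_n}) (M : 'M[A]_n) : 'M[A]_#|I| :=
  mxsub (fun i : 'I_#|I| => enum_val i) (fun i : 'I_#|I| => enum_val i) M.

Definition gamma n (z xi : 'M[A]_n) (k : nat) : A :=
  \sum_(I : {set 'I_n} | #|I| == (2 * k)%N)
    Pf (princ_submx I z) * Pf (princ_submx I xi).

Definition antidiag_mx m : 'M[A]_m := \matrix_(i, j) (j == rev_ord i)%:R.

Definition antidiag_Pf m (M : 'M[A]_m) : A := Pf (M *m antidiag_mx m).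

End Pfaffian.

Section SigmaTilde.

Variables (A : comNzRingType) (n : nat).

(* Row and column indices run over 'I_(n + n), counted from 0: the index i of
   [n] is [pos i], and the index -i, standing for 2n+1-i, is [neg i]. *)
Definition pos (i : 'I_n) : 'I_(n + n) := lshift n i.
Definition neg (i : 'I_n) : 'I_(n + n) := rev_ord (pos i).

Definition X0 (i j : 'I_n) : 'M[A]_(n + n) :=
  delta_mx (pos i) (pos j) - delta_mx (neg j) (neg i).
Definition Xp (i j : 'I_n) : 'M[A]_(n + n) :=
  delta_mx (pos i) (neg j) - delta_mx (pos j) (neg i).
Definition Xm (i j : 'I_n) : 'M[A]_(n + n) :=
  delta_mx (neg j) (pos i) - delta_mx (neg i) (pos j).

Variables (z xi : 'M[A]_n) (u : A) (s : int).

Definition sigma0 (i j : 'I_n) : A :=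
  if i == j then
    u + \sum_(k < n) \sum_(l < n | [&& (k < l)%N, k != i & l != i])
          z k l * xi k l
  else - \sum_(k < n) z k j * xi k i.

Definition sigmap (i j : 'I_n) : A := - xi i j.

Definition sigmam (i j : 'I_n) : A :=
  - (u + s%:~R) * z i j
  - \sum_(k < n)
      \sum_(l < n | [&& (k < l)%N, k != i, k != j, l != i & l != j])
        (z i j * z k l - z i k * z j l + z i l * z j k) * xi k l.

Definition sigmaX : 'M[A]_(n + n) :=
  \sum_(i < n) \sum_(j < n) sigma0 j i *: X0 i j
  + \sum_(i < n) \sum_(j < n | (i < j)%N) sigmam i j *: Xp i j
  + \sum_(i < n) \sum_(j < n | (i < j)%N) sigmap i j *: Xm i j.

End SigmaTilde.

Section Indeterminates.

Variables (C : comNzRingType) (n : nat).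

Definition upair : finType := {p : 'I_n * 'I_n | (p.1 < p.2)%N}.

(* [inl (inl (i, j))], [inl (inr (i, j))] and [inr tt] name the indeterminates
   z_{i,j}, xi_{i,j} (i < j) and u. *)
Definition indet : finType := (upair + upair + unit)%type.

Definition var (v : indet) : {mpoly C[#|indet|]} := 'X_(enum_rank v).

Definition alt_mx (f : upair -> {mpoly C[#|indet|]}) :
    'M[{mpoly C[#|indet|]}]_n :=
  \matrix_(i, j)
    if (insub (i, j) : option upair) is Some p then f p
    else if (insub (j, i) : option upair) is Some p then - f p
    else 0.

Definition zvar : 'M[{mpoly C[#|indet|]}]_n :=
  alt_mx (fun p => var (inl (inl p))).
Definition xivar : 'M[{mpoly C[#|indet|]}]_n :=
  alt_mx (fun p => var (inl (inr p))).
Definition uvar : {mpoly C[#|indet|]} := var (inr tt).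

End Indeterminates.

Arguments zvar C n : clear implicits.
Arguments xivar C n : clear implicits.
Arguments uvar C n : clear implicits.

(* Main.v *)
Require Import Defs.
From mathcomp Require Import all_boot all_order all_fingroup all_algebra.
From mathcomp Require Import reals.
From mathcomp Require Import complex.
From mathcomp Require Import mpoly.
From mathcomp Require Import ring zify.

Set Implicit Arguments.
Unset Strict Implicit.
Unset Printing Implicit Defensive.

Import Order.TTheory GRing.Theory Num.Theory.

Local Open Scope ring_scope.

(** Write w = u + gamma_1 and J for the antidiagonal matrix of size n.  The
    restrictions on the summation indices in the entries of the symbol can be
    lifted: terms that they exclude either vanish or are accounted for by
    gamma_1.  After that, the matrix whose Pfaffian is wanted becomes

      [ - (w + s) z - z xi z   (w + z xi) J ]
      [ - J (w + xi z)             J xi J   ]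

    ([sigmaX_antidiag]).  Congruence by the unipotent matrix with upper right
    block - z J leaves the Pfaffian unchanged ([Pf_congruence]) and clears the
    products of z and xi ([Pf_sigmaX_reduced]):

      [ (w - s) z   w J    ]
      [   - w J     J xi J ]

    The Pfaffian of the latter is expanded according to the set of indices i
    whose two copies i and -i are matched through the entry w.  If S is the
    complementary set, the remaining factor is the Pfaffian of the block
    diagonal form ((w - s) z_S, J xi_S J), so the Pfaffian equals

      sum over S of w^(n - |S|) Pf((w - s) z_S) Pf(J xi_S J)

    ([Pf_block_form_subsets]).  Sets of odd size contribute 0; for |S| = 2k,
    reversing the indices of xi_S costs (-1)^k, and (-1)^k (w - s)^k is
    (s - w)^k.

    Signs are kept under control by working with Pfaffians of a form along a
    list of indices ([Pf_seq]): an exchange of neighbours changes the sign, so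
    permuting whole pairs (i, -i) never does.  This makes the order of the
    index set irrelevant once i and -i are placed next to each other
    ([interleave]), and the nested order 1, ..., n, -n, ..., -1 of the given
    matrix has the same sign as the interleaved one ([Pf_nested]). *)

(** * Sums over permutations *)

Section PfSum.
Variable A : comNzRingType.

Definition pf_term m (M : 'M[A]_m) (s : 'S_m) : A :=
  (-1) ^+ s * \prod_(i < m./2) M (s (even_ord i)) (s (odd_ord i)).

Definition pf_sum m (M : 'M[A]_m) : A := \sum_(s : 'S_m) pf_term M s.

Lemma prod_even_odd m (phi : 'I_m -> A) : ~~ odd m ->
  \prod_(j < m) phi j = \prod_(i < m./2) (phi (even_ord i) * phi (odd_ord i)).
Proof.
move=> em; pose psi k := oapp phi 1 (insub k).
have psiE (j : 'I_m) : phi j = psi j by rewrite /psi valK.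
transitivity (\prod_(0 <= j < m) psi j).
  by rewrite big_mkord; apply: eq_bigr => j _; rewrite psiE.
transitivity (\prod_(0 <= i < m./2) (psi i.*2 * psi i.*2.+1)); last first.
  by rewrite big_mkord; apply: eq_bigr => i _; rewrite !psiE.
rewrite -{1}(even_halfK em); elim: (m./2) => [|h IH]; first by rewrite !big_geq.
by rewrite doubleS !big_nat_recr //= IH mulrA.
Qed.

(** The index map that lists the pairs [f 0], [f 1], ... one after the other;
    the last position is sent to itself when [m] is odd. *)
Definition interleave_pairs m (f : {ffun 'I_m./2 -> 'I_m * 'I_m}) (j : 'I_m) :=
  if insub (j./2) is Some i then if odd j then (f i).2 else (f i).1 else j.

Lemma interleave_even m (f : {ffun 'I_m./2 -> 'I_m * 'I_m}) i :
  interleave_pairs f (even_ord i) = (f i).1.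
Proof. by rewrite /interleave_pairs /= odd_double doubleK valK. Qed.

Lemma interleave_odd m (f : {ffun 'I_m./2 -> 'I_m * 'I_m}) i :
  interleave_pairs f (odd_ord i) = (f i).2.
Proof. by rewrite /interleave_pairs /= odd_double uphalf_double valK. Qed.

(** Multiplying out the product over the pairs turns the sum over permutations
    into a determinant for each choice [f] of column indices.  No injectivity
    of [f] has to be discussed: the determinants with a repeated column are
    zero and may stay in the sum. *)
Lemma pf_sum_congruence_expand m (B M : 'M[A]_m) : ~~ odd m ->
  pf_sum (B *m M *m B^T) =
  \sum_(f : {ffun 'I_m./2 -> 'I_m * 'I_m})
     \det (colsub (interleave_pairs f) B) * \prod_i M (f i).1 (f i).2.
Proof.
move=> em.
transitivity (\sum_(s : 'S_m) \sum_(f : {ffun 'I_m./2 -> 'I_m * 'I_m})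
   (-1) ^+ s * (\prod_j B (s j) (interleave_pairs f j))
    * \prod_i M (f i).1 (f i).2).
  apply: eq_bigr => s _; rewrite /pf_term.
  transitivity ((-1) ^+ s * \prod_(i < m./2) \sum_(p : 'I_m * 'I_m)
     (B (s (even_ord i)) p.1 * B (s (odd_ord i)) p.2 * M p.1 p.2)).
    congr (_ * _); apply: eq_bigr => i _; rewrite !mxE.
    rewrite -(pair_bigA _ (fun a b => B (s (even_ord i)) a * B (s (odd_ord i)) b * M a b)).
    rewrite exchange_big /=; apply: eq_bigr => b _.
    rewrite !mxE mulr_suml; apply: eq_bigr => a _; ring.
  rewrite bigA_distr_bigA mulr_sumr; apply: eq_bigr => f _.
  rewrite (prod_even_odd _ em) -mulrA -big_split /=; congr (_ * _).
  by apply: eq_bigr => i _; rewrite interleave_even interleave_odd.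
rewrite exchange_big; apply: eq_bigr => f _; rewrite -mulr_suml.
congr (_ * _); rewrite -det_tr /determinant; apply: eq_bigr => s _.
rewrite [in RHS](reindex_inj (@perm_inj _ s^-1)) /=.
rewrite [in LHS](reindex_inj (@perm_inj _ s^-1)) /=.
by congr (_ * _); apply: eq_bigr => j _; rewrite !mxE permKV.
Qed.

(** By [pf_sum_congruence_expand], applied to [B] and to the identity matrix,
    as the columns of [B] chosen by [f] form the product of [B] with the same
    choice of columns in the identity. *)
Lemma pf_sum_congruence m (B M : 'M[A]_m) : ~~ odd m ->
  pf_sum (B *m M *m B^T) = \det B * pf_sum M.
Proof.
move=> em; have -> : pf_sum M = pf_sum (1%:M *m M *m 1%:M^T).
  by rewrite trmx1 mulmx1 mul1mx.
rewrite !pf_sum_congruence_expand // mulr_sumr; apply: eq_bigr => f _.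
by rewrite mulrA -det_mulmx mulmx_colsub mulmx1.
Qed.

Lemma sum_lift_perm (V : nmodType) n (F : 'S_n.+1 -> V) (i j : 'I_n.+1) :
  \sum_(s : 'S_n.+1 | s i == j) F s = \sum_(s : 'S_n) F (lift_perm i j s).
Proof.
(* [drop s] is the inverse of [lift_perm]: delete position [i] and the value
   [s i]. *)
pose drop (s : 'S_n.+1) k := odflt k (unlift (s i) (s (lift i k))).
have dropK (s : 'S_n.+1) k : lift (s i) (drop s k) = s (lift i k).
  rewrite /drop; case: unliftP => //= e.
  by move: (neq_lift i k); rewrite -(inj_eq (@perm_inj _ s)) e eqxx.
have drop_inj (s : 'S_n.+1) : injective (drop s).
  by move=> a b e; apply/(@lift_inj _ i)/(@perm_inj _ s); rewrite -!dropK e.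
rewrite (reindex_onto (lift_perm i j) (fun s => perm (@drop_inj s))) /=.
  apply: eq_bigl => s; rewrite lift_perm_id eqxx; apply/eqP/permP => k.
  by rewrite permE /drop lift_perm_lift lift_perm_id liftK.
move=> s /eqP si; apply/permP => k; case: (unliftP i k) => [k'|] ->.
  by rewrite lift_perm_lift permE -si dropK.
by rewrite lift_perm_id.
Qed.

Lemma even_ord_inj m : injective (@even_ord m).
Proof. by move=> a b [] /double_inj /val_inj. Qed.

Lemma odd_ord_inj m : injective (@odd_ord m).
Proof. by move=> a b [] /double_inj /val_inj. Qed.

Lemma even_odd_ord_neq m (a b : 'I_m./2) : even_ord a != odd_ord b.
Proof. by apply/eqP => -[] /(congr1 odd); rewrite /= !odd_double. Qed.

(** Exchanging two whole pairs is a product of two transpositions, hence even: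
    together with the flip inside one pair it carries any position to a given
    one without changing the term of the Pfaffian. *)
Definition pair_swap m (a b : 'I_m./2) : 'S_m :=
  (tperm (even_ord a) (even_ord b) * tperm (odd_ord a) (odd_ord b))%g.

Lemma pair_swap_even m (a b i : 'I_m./2) :
  pair_swap a b (even_ord i) = even_ord (tperm a b i).
Proof.
rewrite permM -(inj_tperm _ _ _ (@even_ord_inj m)) [LHS]tpermD //;
  by rewrite eq_sym even_odd_ord_neq.
Qed.

Lemma pair_swap_odd m (a b i : 'I_m./2) :
  pair_swap a b (odd_ord i) = odd_ord (tperm a b i).
Proof.
rewrite permM [X in tperm (odd_ord _) _ X]tpermD ?even_odd_ord_neq //.
by rewrite (inj_tperm _ _ _ (@odd_ord_inj m)).
Qed.

Lemma pf_term_pair_swap m (M : 'M[A]_m) (a b : 'I_m./2) s :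
  pf_term M (pair_swap a b * s) = pf_term M s.
Proof.
rewrite /pf_term odd_permM odd_permM !odd_tperm.
rewrite !(inj_eq (@even_ord_inj m)) !(inj_eq (@odd_ord_inj m)) addbb addFb.
congr (_ * _); rewrite [RHS](reindex_inj (@perm_inj _ (tperm a b))) /=.
by apply: eq_bigr => i _; rewrite permM pair_swap_even permM pair_swap_odd.
Qed.

Lemma pf_term_flip m (M : 'M[A]_m) (a : 'I_m./2) s :
  (forall i j, M i j = - M j i) ->
  pf_term M (tperm (even_ord a) (odd_ord a) * s) = pf_term M s.
Proof.
move=> skew; rewrite /pf_term odd_permM odd_tperm even_odd_ord_neq.
rewrite signr_addb expr1 mulN1r mulNr -mulrN; congr (_ * _).
rewrite (bigD1 a) //= [in RHS](bigD1 a) //= !permM tpermL tpermR.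
rewrite skew mulNr opprK; congr (_ * _); apply: eq_bigr => i ia.
rewrite !permM [tperm _ _ (even_ord i)]tpermD ?[tperm _ _ (odd_ord i)]tpermD //.
- by rewrite even_odd_ord_neq.
- by rewrite (inj_eq (@odd_ord_inj m)) eq_sym.
- by rewrite (inj_eq (@even_ord_inj m)) eq_sym.
- by rewrite eq_sym even_odd_ord_neq.
Qed.

(** All [m] positions at which the value [v] can occur contribute equally, so
    it may be put at the first place of the pair [a]. *)
Lemma pf_sum_fix_value m (M : 'M[A]_m) (v : 'I_m) (a : 'I_m./2) : ~~ odd m ->
  (forall i j, M i j = - M j i) ->
  pf_sum M = (\sum_(s : 'S_m | s (even_ord a) == v) pf_term M s) *+ m.
Proof.
move=> em skew.
have slot (t : 'I_m) : \sum_(s : 'S_m | s t == v) pf_term M s =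
    \sum_(s : 'S_m | s (even_ord a) == v) pf_term M s.
  have evenslot b : \sum_(s : 'S_m | s (even_ord b) == v) pf_term M s =
      \sum_(s : 'S_m | s (even_ord a) == v) pf_term M s.
    rewrite [LHS](reindex_inj (mulgI (pair_swap a b))) /=.
    apply: eq_big => s; last by rewrite pf_term_pair_swap.
    by rewrite permM pair_swap_even tpermR.
  have ht : (t./2 < m./2)%N by have := ltn_ord t; lia.
  pose b := Ordinal ht; have [ot|et] := boolP (odd t).
    have tE : t = odd_ord b by apply: val_inj => /=; lia.
    rewrite -(evenslot b).
    rewrite [LHS](reindex_inj (mulgI (tperm (even_ord b) (odd_ord b)))).
    apply: eq_big => s; last by rewrite pf_term_flip.
    by rewrite permM [in s _]tE tpermR.
  rewrite -(evenslot b); suff -> : t = even_ord b by [].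
  by apply: val_inj => /=; lia.
rewrite /pf_sum (partition_big (fun s : 'S_m => s^-1%g v) xpredT) //=.
rewrite -[X in _ *+ X](card_ord m) -sumr_const; apply: eq_bigr => t _.
rewrite -(slot t); apply: eq_bigl => s.
by rewrite (canF_eq (permKV s)) eq_sym.
Qed.

(** The value 0 is put at position 0 by [pf_sum_fix_value]; the sum is then
    split according to the value at position 1. *)
Lemma pf_sum_expand m (M : 'M[A]_m.+2) : ~~ odd m ->
  (forall i j, M i j = - M j i) ->
  pf_sum M = (\sum_(j < m.+1) (-1) ^+ j * M 0 (lift 0 j) *
    pf_sum (mxsub (fun i => lift 0 (lift j i)) (fun i => lift 0 (lift j i)) M))
    *+ m.+2.
Proof.
move=> em skew.
pose o : 'I_(m.+2)./2 := Ordinal (ltn0Sn m./2).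
have em2 : ~~ odd m.+2 by rewrite /= negbK.
rewrite (pf_sum_fix_value 0 o em2 skew); congr (_ *+ _).
have -> : even_ord o = 0 by apply: val_inj.
rewrite sum_lift_perm (partition_big (fun s : 'S_m.+1 => s 0) xpredT) //=.
apply: eq_bigr => j _; rewrite sum_lift_perm mulr_sumr; apply: eq_bigr => s _.
rewrite /pf_term odd_lift_perm addFb odd_lift_perm addFb signr_addb signr_odd.
rewrite -!mulrA; congr (_ * _); rewrite mulrCA; congr (_ * _).
rewrite big_ord_recl; congr (_ * _).
  rewrite (_ : even_ord _ = 0) 1?(_ : odd_ord _ = lift 0 0); try exact: val_inj.
  by rewrite lift_perm_lift !lift_perm_id.
apply: eq_bigr => i _; rewrite !mxE.
rewrite (_ : even_ord _ = lift 0 (lift 0 (even_ord i))); last exact: val_inj.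
rewrite (_ : odd_ord _ = lift 0 (lift 0 (odd_ord i))); last exact: val_inj.
by rewrite !lift_perm_lift.
Qed.

Lemma pf_sum_mxsub_perm m (M : 'M[A]_m) (t : 'S_m) :
  pf_sum (mxsub t t M) = (-1) ^+ t * pf_sum M.
Proof.
rewrite /pf_sum mulr_sumr [RHS](reindex_inj (mulIg t)) /=.
apply: eq_bigr => s _; rewrite /pf_term odd_permM signr_addb.
rewrite [RHS]mulrA [_ * (_ * _)]mulrCA -expr2 sqrr_sign mulr1.
by congr (_ * _); apply: eq_bigr => i _; rewrite !mxE !permM.
Qed.

End PfSum.

(** * Pfaffians of matrices and of lists of indices *)

Section PfaffianTheory.
Variables (K : numFieldType) (A : comAlgType K).

Lemma Pf_odd m (M : 'M[A]_m) : odd m -> Pf M = 0.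
Proof. by rewrite /Pf => ->. Qed.

Lemma Pf_even m (M : 'M[A]_m) : ~~ odd m ->
  Pf M = ((2 ^ m./2 * (m./2)`!)%:R : K)^-1 *: pf_sum M.
Proof. by rewrite /Pf => /negbTE ->. Qed.

Lemma Pf_congruence m (B M : 'M[A]_m) : Pf (B *m M *m B^T) = \det B * Pf M.
Proof.
have [om|em] := boolP (odd m); first by rewrite !Pf_odd ?mulr0.
by rewrite !Pf_even // pf_sum_congruence // scalerAr.
Qed.

Lemma Pf_mxsub_perm m (M : 'M[A]_m) (t : 'S_m) :
  Pf (mxsub t t M) = (-1) ^+ t * Pf M.
Proof.
have [om|em] := boolP (odd m); first by rewrite !Pf_odd ?mulr0.
by rewrite !Pf_even // pf_sum_mxsub_perm scalerAr.
Qed.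

(** The factor [m + 2] of [pf_sum_expand] is the ratio of the normalising
    constants in sizes [m + 2] and [m]. *)
Lemma Pf_expand m (M : 'M[A]_m.+2) : (forall i j, M i j = - M j i) ->
  Pf M = \sum_(j < m.+1) (-1) ^+ j * M 0 (lift 0 j) *
    Pf (mxsub (fun i => lift 0 (lift j i)) (fun i => lift 0 (lift j i)) M).
Proof.
move=> skew; have [om|em] := boolP (odd m).
  rewrite Pf_odd /= ?negbK // big1 // => j _.
  by rewrite [X in _ * X]Pf_odd ?mulr0.
rewrite Pf_even /= ?negbK // pf_sum_expand //.
rewrite -scaler_nat scalerA scaler_sumr; apply: eq_bigr => j _.
rewrite [X in _ = _ * X]Pf_even // -!scalerAr; congr (_ *: _).
have -> : m.+2%:R = (2 * (m./2).+1)%:R :> K by congr (_%:R); lia.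
have -> : (2 ^ m./2.+1 * m./2.+1`! = 2 * m./2.+1 * (2 ^ m./2 * m./2`!))%N.
  by rewrite expnS factS mulnACA.
by rewrite natrM invfM mulrAC mulVf ?mul1r // pnatr_eq0.
Qed.

Lemma Pf_size0 (M : 'M[A]_0) : Pf M = 1.
Proof.
rewrite Pf_even // /pf_sum (eq_bigr (fun=> 1)) => [|s _].
  by rewrite sumr_const card_Sn /= invr1 scale1r.
have -> : s = 1%g by apply/permP => -[].
by rewrite /pf_term odd_perm1 big_ord0 mulr1.
Qed.

Lemma Pf_scale m a (M : 'M[A]_m) : Pf (a *: M) = a ^+ m./2 * Pf M.
Proof.
have [om|em] := boolP (odd m); first by rewrite !Pf_odd ?mulr0.
rewrite !Pf_even // -scalerAr mulr_sumr; congr (_ *: _); apply: eq_bigr => s _.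
rewrite mulrCA; congr (_ * _).
rewrite -[in a ^+ _](card_ord m./2) -prodr_const -big_split /=.
by apply: eq_bigr => i _; rewrite mxE.
Qed.

Section PfSeq.
Variable X : eqType.
Implicit Types (F : X -> X -> A) (l p r : seq X).

(** Indexing by lists lets index sets be concatenated, reordered and shortened
    without transporting matrices between sizes that are only provably equal. *)
Definition Pf_seq F l : A :=
  Pf (\matrix_(i, j) F (tnth (in_tuple l) i) (tnth (in_tuple l) j)).

Lemma Pf_seq_nth x0 m F l : size l = m ->
  Pf_seq F l = Pf (\matrix_(i < m, j < m) F (nth x0 l i) (nth x0 l j)).
Proof.
move=> <-; congr Pf; apply/matrixP => i j.
by rewrite !mxE !(tnth_nth x0).
Qed.

Lemma Pf_seq_nil F : Pf_seq F [::] = 1.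
Proof. exact: Pf_size0. Qed.

Lemma Pf_seq_odd F l : odd (size l) -> Pf_seq F l = 0.
Proof. exact: Pf_odd. Qed.

Lemma eq_Pf_seq F F' l : {in l &, F =2 F'} -> Pf_seq F l = Pf_seq F' l.
Proof.
move=> e; congr Pf; apply/matrixP => i j.
by rewrite !mxE e // mem_tnth.
Qed.

Lemma Pf_seq_map (Y : eqType) (h : Y -> X) F (l : seq Y) :
  Pf_seq F (map h l) = Pf (\matrix_(i, j)
    F (h (tnth (in_tuple l) i)) (h (tnth (in_tuple l) j))).
Proof.
case: l => [|y l]; first by rewrite Pf_seq_nil Pf_size0.
rewrite (@Pf_seq_nth (h y) (size (y :: l))) ?size_map //.
congr Pf; apply/matrixP => i j.
by rewrite !mxE !(tnth_nth y) !(nth_map y).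
Qed.

Definition drop_nth j l := take j l ++ drop j.+1 l.

Lemma nth_drop_nth x0 j l i : (j < size l)%N ->
  nth x0 (drop_nth j l) i = nth x0 l (bump j i).
Proof.
move=> jl; rewrite nth_cat size_take jl /bump; case: ltnP => h.
  by rewrite nth_take.
by rewrite nth_drop; congr nth; lia.
Qed.

Lemma size_drop_nth j l : (j < size l)%N -> size (drop_nth j l) = (size l).-1.
Proof. by move=> h; rewrite size_cat size_take size_drop h; lia. Qed.

Lemma Pf_seq_expand F x l : (forall a b, F a b = - F b a) ->
  Pf_seq F (x :: l) = \sum_(j < size l)
    (-1) ^+ j * F x (nth x l j) * Pf_seq F (drop_nth j l).
Proof.
move=> skew; case: l => [|y l]; first by rewrite big_ord0 Pf_seq_odd.
rewrite (@Pf_seq_nth x (size l).+2) // Pf_expand => [|i j]; last by rewrite !mxE.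
apply: eq_bigr => j _; rewrite !mxE; congr (_ * _).
rewrite (@Pf_seq_nth x (size l)) ?size_drop_nth //; congr Pf.
by apply/matrixP => a b; rewrite !mxE !nth_drop_nth.
Qed.

Lemma Pf_seq_swap F p x y r :
  Pf_seq F (p ++ x :: y :: r) = - Pf_seq F (p ++ y :: x :: r).
Proof.
set l := p ++ _; pose m := size l.
have hp : (size p < m)%N by rewrite /m size_cat /=; lia.
have hp1 : ((size p).+1 < m)%N by rewrite /m size_cat /=; lia.
pose t := tperm (Ordinal hp) (Ordinal hp1).
rewrite (@Pf_seq_nth x m) //.
rewrite (@Pf_seq_nth x m F (p ++ _)); last by rewrite /m /l !size_cat.
have -> : - Pf (\matrix_(i < m, j < m) F (nth x (p ++ y :: x :: r) i)
       (nth x (p ++ y :: x :: r) j)) = (-1) ^+ t *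
     Pf (\matrix_(i < m, j < m) F (nth x (p ++ y :: x :: r) i)
       (nth x (p ++ y :: x :: r) j)).
  rewrite odd_tperm -val_eqE /= neq_ltn ltnSn expr1; ring.
rewrite -Pf_mxsub_perm; congr Pf.
have e (i : 'I_m) : nth x l i = nth x (p ++ y :: x :: r) (t i).
  rewrite /l /t; case: tpermP => [->|->|ni1 ni2].
  - by rewrite !nth_cat ltnn subnn ltnNge leqnSn /= subSnn.
  - by rewrite !nth_cat ltnn subnn ltnNge leqnSn /= subSnn.
  rewrite !nth_cat; case: ltnP => // h.
  have : (i - size p)%N != 0%N.
    by apply/eqP => e; apply: ni1; apply: val_inj => /=; lia.
  have : (i - size p)%N != 1%N.
    by apply/eqP => e; apply: ni2; apply: val_inj => /=; lia.
  by case: (i - size p)%N => [|[]].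
by apply/matrixP => i j; rewrite !mxE -!e.
Qed.

Lemma Pf_seq_move F p x q r :
  Pf_seq F (p ++ x :: q ++ r) = (-1) ^+ size q * Pf_seq F (p ++ q ++ x :: r).
Proof.
elim: q p => [|y q IH] p; first by rewrite mul1r.
rewrite Pf_seq_swap -cat_rcons IH cat_rcons exprS; ring.
Qed.

Lemma Pf_seq_rev F p l :
  Pf_seq F (p ++ rev l) = (-1) ^+ 'C(size l, 2) * Pf_seq F (p ++ l).
Proof.
elim: l p => [|x l IH] p; first by rewrite mul1r.
rewrite rev_cons -cats1 -[rev l ++ _]cats0 -catA /=.
have := Pf_seq_move F p x (rev l) [::]; rewrite cats0 size_rev => h.
have -> : Pf_seq F (p ++ rev l ++ [:: x]) =
   (-1) ^+ size l * Pf_seq F (p ++ x :: rev l).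
  by rewrite h mulrA -expr2 sqrr_sign mul1r.
by rewrite -cat_rcons IH cat_rcons binS bin1 addnC exprD mulrA.
Qed.

(** Expanding along the first index, only deletions inside [l1] survive. *)
Lemma Pf_seq_cat F l1 l2 : (forall a b, F a b = - F b a) ->
  {in l1 & l2, forall a b, F a b = 0} ->
  Pf_seq F (l1 ++ l2) = Pf_seq F l1 * Pf_seq F l2.
Proof.
move=> skew; have [k] := ubnP (size l1).
elim: k l1 => // k IH [|x l1] sl Z.
  by rewrite Pf_seq_nil mul1r.
rewrite cat_cons !Pf_seq_expand // size_cat big_split_ord /= addrC big1; last first.
  move=> j _; rewrite nth_cat ltnNge leq_addr /= addKn Z ?mulr0 ?mul0r //.
    by rewrite inE eqxx.
  exact: mem_nth.
rewrite add0r mulr_suml; apply: eq_bigr => j _ /=; rewrite -[RHS]mulrA.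
rewrite nth_cat ltn_ord; congr (_ * _).
have hj := ltn_ord j.
have -> : drop_nth j (l1 ++ l2) = drop_nth j l1 ++ l2.
  rewrite /drop_nth take_cat drop_cat hj; case: ltnP => h; first by rewrite catA.
  by rewrite (drop_oversize (s := l1)) // cats0 (eqP (_ : j.+1 - size l1 == 0)%N) ?drop0 //; lia.
apply: IH => [|a b]; first by move: sl; rewrite size_drop_nth //=; lia.
move=> ha; apply: Z; rewrite inE; apply/orP; right.
by move: ha; rewrite mem_cat => /orP[/mem_take|/mem_drop].
Qed.

End PfSeq.
End PfaffianTheory.

(** * Forms on two copies of an index set *)

Section DoubledIndices.
Variables (K : numFieldType) (A : comAlgType K) (I : finType).
Implicit Types (F : I + I -> I + I -> A) (l : seq I) (p : seq (I + I)).
Implicit Types D E J : {set I}.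

Definition interleave l : seq (I + I) := flatten [seq [:: inl i; inr i] | i <- l].

Arguments interleave : simpl never.

Lemma interleave_cons i l :
  interleave (i :: l) = inl i :: inr i :: interleave l.
Proof. by []. Qed.

Lemma interleave_cat l1 l2 : interleave (l1 ++ l2) = interleave l1 ++ interleave l2.
Proof. by rewrite /interleave map_cat flatten_cat. Qed.

Lemma size_interleave l : size (interleave l) = (size l).*2.
Proof. by elim: l => // x l IH; rewrite interleave_cons /= IH. Qed.

Lemma mem_interleave_inl l i : (inl i \in interleave l) = (i \in l).
Proof. by elim: l => // x l IH; rewrite interleave_cons !inE IH. Qed.

Lemma mem_interleave_inr l i : (inr i \in interleave l) = (i \in l).
Proof. by elim: l => // x l IH; rewrite interleave_cons !inE IH. Qed.

(** Moving one index past an interleaved list costs an even number of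
    exchanges. *)
Lemma Pf_interleave_perm F p l l' : perm_eq l l' ->
  Pf_seq F (p ++ interleave l) = Pf_seq F (p ++ interleave l').
Proof.
elim: l p l' => [|x l IH] p l' ll'.
  by move: ll'; rewrite perm_sym => /perm_nilP ->.
have xl' : x \in l' by rewrite -(perm_mem ll') mem_head.
case/splitPr: xl' ll' => l1 l2; rewrite perm_sym -cat1s perm_catCA /= perm_cons perm_sym => ll'.
rewrite interleave_cat !interleave_cons.
have even_sign : (-1) ^+ size (interleave l1) = 1 :> A.
  by rewrite size_interleave -signr_odd odd_double.
have := Pf_seq_move F p (inl x) (interleave l1) (inr x :: interleave l2).
rewrite even_sign mul1r => <-.
have := Pf_seq_move F (rcons p (inl x)) (inr x) (interleave l1) (interleave l2).
rewrite even_sign mul1r !cat_rcons => <-.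
have := IH (p ++ [:: inl x; inr x]) _ ll'.
by rewrite interleave_cat -!catA.
Qed.

(** Each outermost [inr x] moves next to its [inl x] past an even number of
    indices. *)
Lemma Pf_nested F p l :
  Pf_seq F (p ++ map inl l ++ rev (map inr l)) = Pf_seq F (p ++ interleave l).
Proof.
elim: l p => [|x l IH] p //; rewrite interleave_cons /=.
rewrite rev_cons -cats1.
have := Pf_seq_move F (rcons p (inl x)) (inr x) (map inl l ++ rev (map inr l)) [::].
rewrite size_cat size_rev !size_map addnn -signr_odd odd_double mul1r cats0.
rewrite !cat_rcons -!catA => <-.
by have := IH (p ++ [:: inl x; inr x]); rewrite -!catA.
Qed.

Section Blocks.
Variables (a b : I -> I -> A) (w : A).
Hypothesis a_skew : forall i j, a i j = - a j i.
Hypothesis b_skew : forall i j, b i j = - b j i.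

(** The form with matrix [[a, w], [- w, b]], where the entry [w] is kept only
    at the indices of [D]: shrinking [D] one index at a time isolates the
    contribution of each [w]. *)
Definition block_form D (x y : I + I) : A :=
  match x, y with
  | inl i, inl j => a i j
  | inr i, inr j => b i j
  | inl i, inr j => if (i == j) && (i \in D) then w else 0
  | inr i, inl j => if (i == j) && (i \in D) then - w else 0
  end.

Lemma block_form_skew D x y : block_form D x y = - block_form D y x.
Proof.
case: x y => [i|i] [j|j] //=; rewrite eq_sym.
  by case: eqP => [->|_] /=; [case: ifP|]; rewrite ?opprK ?oppr0.
by case: eqP => [->|_] /=; [case: ifP|]; rewrite ?oppr0.
Qed.

Lemma block_form_setD1 D i x y : x != inl i -> y != inl i ->
  block_form D x y = block_form (D :\ i) x y.
Proof.
by case: x y => [j|j] [k|k] //= jk ki; rewrite !inE;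
  case: (j =P k) => //= ?; subst; rewrite ?jk ?ki.
Qed.

(** The entry [w] at [i] occurs only in the expansion along [inl i], where it
    multiplies the Pfaffian along the other indices. *)
Lemma Pf_block_form_step D i l : i \in D -> i \notin l ->
  Pf_seq (block_form D) (interleave (i :: l)) =
  Pf_seq (block_form (D :\ i)) (interleave (i :: l)) +
  w * Pf_seq (block_form (D :\ i)) (interleave l).
Proof.
move=> iD il; rewrite interleave_cons !Pf_seq_expand; try exact: block_form_skew.
rewrite /= !big_ord_recl /= /drop_nth /= !drop0 !inE !eqxx iD /= !mul1r mul0r.
rewrite add0r addrC; congr (_ + _ * _); last first.
  apply: eq_Pf_seq => x y xl yl; apply: block_form_setD1.
    by apply: contraNneq il => e; rewrite -mem_interleave_inl -e.
  by apply: contraNneq il => e; rewrite -mem_interleave_inl -e.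
apply: eq_bigr => j _; rewrite /bump /= add1n.
have nl k : k \in interleave l -> k != inl i /\ k != inr i.
  move=> kl; split; apply: contraNneq il => e.
    by rewrite -mem_interleave_inl -e.
  by rewrite -mem_interleave_inr -e.
congr (_ * _ * _).
  have := nl _ (mem_nth (inl i) (ltn_ord j)); case: (nth _ _ _) => k //= [_ ki].
  by case: eqP => //= e; move: ki; rewrite e eqxx.
apply: eq_Pf_seq => x y xl yl; apply: block_form_setD1.
  move: xl; rewrite inE => /orP[/eqP -> //|].
  by rewrite mem_cat => /orP[/mem_take|/mem_drop] /nl [].
move: yl; rewrite inE => /orP[/eqP -> //|].
by rewrite mem_cat => /orP[/mem_take|/mem_drop] /nl [].
Qed.

(** [J] is the set of those indices of [D] at which [w] is not used; the
    indices of [E] have no entry [w] from the start, and the induction on [D]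
    moves indices from [D] to [E]. *)
Lemma Pf_block_form_subsets D E : [disjoint D & E] ->
  Pf_seq (block_form D) (interleave (enum (D :|: E))) =
  \sum_(J : {set I} | J \subset D)
    w ^+ (#|D| - #|J|) * Pf_seq (block_form set0) (interleave (enum (J :|: E))).
Proof.
have [k] := ubnP #|D|; elim: k D E => // k IH D E.
have [-> _ _|[x xD]] := set_0Vmem D.
  rewrite (big_pred1 set0) => [|J]; last by rewrite subset0.
  by rewrite cards0 mul1r.
move=> Dk dis; have xE : x \notin E by rewrite (disjointFr dis xD).
have cD : #|D| = #|D :\ x|.+1 by rewrite (cardsD1 x D) xD.
have dis' : [disjoint D :\ x & E] by apply: disjointWl dis; apply: subsetDl.
have pe : perm_eq (enum (D :|: E)) (x :: enum ((D :\ x) :|: E)).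
  apply: uniq_perm; rewrite ?enum_uniq //=.
    by rewrite mem_enum !inE eqxx (negbTE xE) enum_uniq.
  move=> y; rewrite !(inE, mem_enum); case: eqP => // -> ; by rewrite xD.
have pe' : perm_eq (x :: enum ((D :\ x) :|: E)) (enum ((D :\ x) :|: (x |: E))).
  apply: uniq_perm; rewrite ?enum_uniq //=.
    by rewrite mem_enum !inE eqxx (negbTE xE) enum_uniq.
  by move=> y; rewrite !(inE, mem_enum); case: eqP => //=.
rewrite (@Pf_interleave_perm _ [::] _ _ pe) Pf_block_form_step //; last first.
  by rewrite mem_enum !inE eqxx (negbTE xE).
rewrite (@Pf_interleave_perm _ [::] _ _ pe') /=.
have dis'' : [disjoint D :\ x & x |: E].
  rewrite -setI_eq0; apply/eqP/setP => y; rewrite !inE; case: eqP => //= _.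
  by apply: negbTE; rewrite negb_and; case: (boolP (y \in D)) => //= /(disjointFr dis) ->.
rewrite !IH //; try lia.
rewrite [RHS](bigID (fun J : {set I} => x \in J)) /=; congr (_ + _).
  rewrite [RHS](reindex_onto (fun J => x |: J) (fun J => J :\ x)) /=; last first.
    by move=> J /andP[_ xJ]; rewrite setD1K.
  have xJE (J : {set I}) : ((x |: J) :\ x == J) = (x \notin J).
    apply/eqP/idP => [<-|xJ]; first by rewrite !inE eqxx.
    by rewrite setU1K.
  apply: eq_big => J.
    by rewrite setU11 andbT subUset sub1set xD /= xJE subsetD1.
  rewrite subsetD1 => /andP[JD xJ]; rewrite setUCA setUA; congr (_ ^+ _ * _).
  by rewrite cardsU1 xJ cD add1n subSS.
rewrite mulr_sumr; apply: eq_big => J; first by rewrite subsetD1.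
move=> JD; rewrite mulrA -exprS cD subSn //; exact: subset_leq_card.
Qed.

Lemma Pf_block_diag l :
  Pf_seq (block_form set0) (interleave l) =
  (-1) ^+ 'C(size l, 2) * Pf_seq a l * Pf_seq b l.
Proof.
rewrite -[interleave l]cat0s -Pf_nested cat0s Pf_seq_cat; first last.
- move=> x y /mapP[i _ ->]; rewrite mem_rev => /mapP[j _ ->] /=.
  by rewrite inE andbF.
- exact: block_form_skew.
rewrite -[rev _]cat0s Pf_seq_rev size_map !Pf_seq_map; rewrite /Pf_seq /=; ring.
Qed.

(** Grouping the sets [J] by size: the odd ones have Pfaffian 0, and the sign
    of the reversal of [2 k] indices is [(-1) ^ k]. *)
Lemma Pf_block_form :
  Pf_seq (block_form setT) (map inl (enum I) ++ rev (map inr (enum I))) =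
  \sum_(k < (#|I|./2).+1) w ^+ (#|I| - 2 * k) * (-1) ^+ k *
    \sum_(J : {set I} | #|J| == (2 * k)%N) Pf_seq a (enum J) * Pf_seq b (enum J).
Proof.
have := Pf_nested (block_form setT) [::] (enum I); rewrite !cat0s => ->.
have -> : enum I = enum ([set: I] :|: set0).
  by rewrite setU0 enum_setT enumT.
rewrite Pf_block_form_subsets; last by rewrite -setI_eq0 setI0.
rewrite cardsT.
transitivity (\sum_(J : {set I}) w ^+ (#|I| - #|J|) *
    ((-1) ^+ 'C(#|J|, 2) * (Pf_seq a (enum J) * Pf_seq b (enum J)))).
  apply: eq_big => J; first by rewrite subsetT.
  by rewrite setU0 Pf_block_diag -cardE !mulrA.
rewrite (bigID (fun J : {set I} => odd #|J|)) /= big1 ?add0r; last first.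
  by move=> J oJ; rewrite Pf_seq_odd ?mul0r ?mulr0 // -cardE.
rewrite (partition_big (fun J : {set I} => inord #|J|./2 : 'I_(#|I|./2).+1) xpredT) //=.
apply: eq_bigr => k _; rewrite mulr_sumr.
apply: eq_big => J.
  have hJ := max_card J.
  rewrite -val_eqE /= inordK; last by rewrite ltnS half_leq.
  by apply/idP/idP; lia.
move=> /andP[eJ /eqP/(congr1 val)]; rewrite /= inordK; last first.
  by rewrite ltnS half_leq // max_card.
move=> Jk; have -> : #|J| = (2 * k)%N by lia.
rewrite -mulrA; congr (_ * (_ * _)).
rewrite -signr_odd -[RHS]signr_odd; congr (_ ^+ nat_of_bool _).
by rewrite bin2; case: (val k) => // q; rewrite mulnC; lia.
Qed.

End Blocks.
End DoubledIndices.

(** * The matrix of symbols *)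

Section Antidiagonal.
Variables (K : fieldType) (A : comAlgType K).

Lemma mulmx_antidiag m n (M : 'M[A]_(m, n)) i j :
  (M *m antidiag_mx A n) i j = M i (rev_ord j).
Proof.
rewrite mxE (bigD1 (rev_ord j)) //= mxE rev_ordK eqxx mulr1 big1 ?addr0 // => k kj.
by rewrite mxE -(inj_eq rev_ord_inj) rev_ordK eq_sym (negbTE kj) mulr0.
Qed.

Lemma tr_antidiag n : (antidiag_mx A n)^T = antidiag_mx A n.
Proof.
apply/matrixP => i j; rewrite !mxE.
by rewrite -(inj_eq rev_ord_inj) rev_ordK eq_sym.
Qed.

Lemma antidiag_mulmx m n (M : 'M[A]_(m, n)) i j :
  (antidiag_mx A m *m M) i j = M (rev_ord i) j.
Proof. by rewrite -[antidiag_mx A m *m M]trmxK mxE trmx_mul tr_antidiag mulmx_antidiag mxE. Qed.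

Lemma antidiag_sqr n : antidiag_mx A n *m antidiag_mx A n = 1%:M.
Proof.
apply/matrixP => i j; rewrite antidiag_mulmx !mxE rev_ordK.
by rewrite eq_sym.
Qed.

End Antidiagonal.

Section SumLt.
Variables (V : nmodType) (n : nat).

(** Used to turn sums over k < l into entries of matrix products. *)
Lemma sum_lt_symmetrize (h : 'I_n -> 'I_n -> V) : (forall k, h k k = 0) ->
  \sum_(k < n) \sum_(l < n | (k < l)%N) (h k l + h l k) =
  \sum_(k < n) \sum_(l < n) h k l.
Proof.
move=> h0; under eq_bigr do rewrite big_split; rewrite big_split /=.
rewrite [X in _ + X](exchange_big_dep xpredT) //= -big_split /=.
apply: eq_bigr => k _; rewrite [RHS](bigID (fun l : 'I_n => (k < l)%N)) /=.
congr (_ + _); rewrite [RHS](bigD1 k) ?ltnn //= h0 add0r.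
by apply: eq_bigl => l; rewrite -val_eqE /=; lia.
Qed.

End SumLt.

Section SymbolMatrix.
Variables (A : comNzRingType) (n : nat).
Implicit Types (z xi M : 'M[A]_n) (i j k l : 'I_n).

Lemma rev_ord_lshift i : rev_ord (lshift n i) = neg i.
Proof. by []. Qed.

Lemma rshift_neg i : rshift n i = neg (rev_ord i).
Proof. by apply: val_inj => /=; have := ltn_ord i; lia. Qed.

Lemma rev_ord_rshift i : rev_ord (rshift n i) = pos (rev_ord i).
Proof. by rewrite rshift_neg /neg rev_ordK. Qed.

Lemma pos_eq i j : (pos i == pos j) = (i == j).
Proof. exact: (inj_eq (@lshift_inj n n)). Qed.

Lemma neg_eq i j : (neg i == neg j) = (i == j).
Proof. by rewrite (inj_eq rev_ord_inj) pos_eq. Qed.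

Lemma pos_neg_eq i j : (pos i == neg j) = false.
Proof. by apply/eqP => /(congr1 val) /=; have := ltn_ord i; have := ltn_ord j; lia. Qed.

Lemma neg_pos_eq i j : (neg i == pos j) = false.
Proof. by rewrite eq_sym pos_neg_eq. Qed.

Variables (z xi : 'M[A]_n) (u : A) (s : int).
Hypotheses (z_skew : forall i j, z i j = - z j i) (z_diag : forall i, z i i = 0).
Hypotheses (xi_skew : forall i j, xi i j = - xi j i) (xi_diag : forall i, xi i i = 0).

Let w := u + \sum_(k < n) \sum_(l < n | (k < l)%N) z k l * xi k l.

(** The terms of gamma_1 that the symbol leaves out are those with k = i or
    l = i; by skew symmetry they add up to the diagonal entry of - xi z. *)
Lemma sigma0E i j : sigma0 z xi u i j = (w%:M + xi *m z) i j.
Proof.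
rewrite !mxE /sigma0; case: eqP => [<-|_]; last first.
  by rewrite mulr0n add0r -sumrN; apply: eq_bigr => k _; rewrite (xi_skew k) mulrN opprK mulrC.
rewrite mulr1n /w -addrA; congr (_ + _).
have -> : \sum_(k < n) xi i k * z k i =
   - \sum_(k < n) \sum_(l < n) (k == i)%:R * (z k l * xi k l).
  rewrite [in RHS](bigD1 i) //= [X in - (_ + X)]big1 ?addr0; last first.
    by move=> k /negbTE ->; rewrite big1 // => l _; rewrite mul0r.
  by rewrite -sumrN; apply: eq_bigr => k _; rewrite eqxx mul1r (z_skew k) mulrN mulrC.
rewrite -sum_lt_symmetrize => [|k]; last by rewrite z_diag mul0r mulr0.
rewrite -sumrB; apply: eq_bigr => k _; rewrite -sumrB.
rewrite [RHS]big_mkcond [LHS]big_mkcond /=; apply: eq_bigr => l _.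
case: ltnP => //= kl; rewrite (z_skew l) (xi_skew l) mulrNN.
have [ki|ki] := eqVneq k i; have [li|li] := eqVneq l i => /=; try ring.
by move: kl; rewrite ki li ltnn.
Qed.

(** The bracket in the symbol is the Pfaffian of z on the indices i, j, k, l;
    it vanishes when two of them agree, so k and l may range freely. *)
Lemma sigmamE i j :
  sigmam z xi u s i j = (- (w + s%:~R) *: z - z *m xi *m z) i j.
Proof.
rewrite -mulmxA !mxE /sigmam.
have -> : \sum_k z i k * (xi *m z) k j =
  - \sum_(k < n) \sum_(l < n) z i k * z j l * xi k l.
  rewrite -sumrN; apply: eq_bigr => k _; rewrite mxE mulr_sumr -sumrN.
  by apply: eq_bigr => l _; rewrite (z_skew j); ring.
rewrite -sum_lt_symmetrize => [|k]; last by rewrite xi_diag mulr0.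
have -> : - (w + s%:~R) * z i j =
   - (u + s%:~R) * z i j - \sum_(k < n) \sum_(l < n | (k < l)%N) z i j * z k l * xi k l.
  rewrite /w; under [in RHS]eq_bigr do under eq_bigr do rewrite -mulrA.
  under [in RHS]eq_bigr do rewrite -mulr_sumr.
  rewrite -mulr_sumr; ring.
rewrite -[RHS]addrA; congr (_ + _); rewrite -opprD; congr (- _).
rewrite -sumrB; apply: eq_bigr => k _; rewrite -sumrB.
rewrite [RHS]big_mkcond [LHS]big_mkcond /=; apply: eq_bigr => l _.
case: ltnP => //= kl.
have e : z i j * z k l * xi k l - (z i k * z j l * xi k l + z i l * z j k * xi l k)
   = (z i j * z k l - z i k * z j l + z i l * z j k) * xi k l.
  by rewrite (xi_skew l); ring.
rewrite e; case: ifP => // /negbT.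
rewrite !negb_and !negbK => /or4P[] /eqP ->; rewrite ?z_diag.
- by rewrite (z_skew j i); ring.
- ring.
- by rewrite (z_skew j i) (z_skew k i); ring.
- by rewrite (z_skew k j); ring.
Qed.

Lemma sigmam_skew i j : sigmam z xi u s i j = - sigmam z xi u s j i.
Proof.
rewrite !sigmamE.
have zT : z^T = - z by apply/matrixP => a b; rewrite !mxE.
have xiT : xi^T = - xi by apply/matrixP => a b; rewrite !mxE.
set Y := _ - _; have YT : Y^T = - Y.
  rewrite /Y linearB /= linearZ /= !trmx_mul zT xiT.
  by rewrite !(mulNmx, mulmxN) !opprK mulmxA scalerN opprB addrC.
by have := congr1 (fun N : 'M_n => N j i) YT; rewrite [LHS]mxE [RHS]mxE.
Qed.

Lemma sum_delta (c : 'I_n -> 'I_n -> A) a b :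
  \sum_i \sum_j c i j * ((a == i) && (b == j))%:R = c a b.
Proof.
rewrite (bigD1 a) //= [X in _ + X]big1 ?addr0 => [|i ia]; last first.
  by rewrite big1 // => j _; rewrite eq_sym (negbTE ia) mulr0.
rewrite (bigD1 b) //= big1 ?addr0 ?eqxx ?mulr1 // => j jb.
by rewrite eq_sym (negbTE jb) andbF mulr0.
Qed.

Lemma sum_lt_delta (c : 'I_n -> 'I_n -> A) a b :
  (forall i j, c i j = - c j i) -> (forall i, c i i = 0) ->
  \sum_(i < n) \sum_(j < n | (i < j)%N)
     c i j * (((a == i) && (b == j))%:R - ((a == j) && (b == i))%:R) = c a b.
Proof.
move=> cskew cdiag; rewrite -[RHS]sum_delta -sum_lt_symmetrize => [|k].
  by apply: eq_bigr => i _; apply: eq_bigr => j _; rewrite (cskew j i); ring.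
by rewrite cdiag mul0r.
Qed.


Let delta_entry := (pos_eq, neg_eq, pos_neg_eq, neg_pos_eq).

Lemma X0E i j a b :
  (X0 A i j (pos a) (pos b) = ((a == i) && (b == j))%:R) *
  (X0 A i j (pos a) (neg b) = 0) * (X0 A i j (neg a) (pos b) = 0) *
  (X0 A i j (neg a) (neg b) = - ((a == j) && (b == i))%:R).
Proof. by rewrite /X0 !mxE !delta_entry !andbF !subr0 !sub0r. Qed.

Lemma XpE i j a b :
  (Xp A i j (pos a) (pos b) = 0) * (Xp A i j (neg a) (pos b) = 0) *
  (Xp A i j (pos a) (neg b) =
     ((a == i) && (b == j))%:R - ((a == j) && (b == i))%:R) *
  (Xp A i j (neg a) (neg b) = 0).
Proof. by rewrite /Xp !mxE !delta_entry !andbF !subr0. Qed.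

Lemma XmE i j a b :
  (Xm A i j (pos a) (pos b) = 0) * (Xm A i j (pos a) (neg b) = 0) *
  (Xm A i j (neg a) (pos b) =
     - (((a == i) && (b == j))%:R - ((a == j) && (b == i))%:R)) *
  (Xm A i j (neg a) (neg b) = 0).
Proof. by rewrite /Xm !mxE !delta_entry !andbF !subr0 opprB. Qed.

Let sum0 (P : 'I_n -> 'I_n -> bool) (c : 'I_n -> 'I_n -> 'M[A]_(n + n)) x y :
  (forall i j, c i j x y = 0) ->
  (\sum_i \sum_(j | P i j) c i j) x y = 0.
Proof. by move=> c0; rewrite summxE big1 // => i _; rewrite summxE big1. Qed.

Lemma sigmaX_pos_pos a b : sigmaX z xi u s (pos a) (pos b) = sigma0 z xi u b a.
Proof.
rewrite /sigmaX 2!mxE [X in _ + X + _]sum0 ?[X in _ + X]sum0 ?addr0;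
  try by move=> i j; rewrite mxE ?XpE ?XmE mulr0.
rewrite summxE -[RHS](sum_delta (fun i j => sigma0 z xi u j i)).
by apply: eq_bigr => i _; rewrite summxE; apply: eq_bigr => j _; rewrite mxE X0E.
Qed.

Lemma sigmaX_neg_neg a b : sigmaX z xi u s (neg a) (neg b) = - sigma0 z xi u a b.
Proof.
rewrite /sigmaX 2!mxE [X in _ + X + _]sum0 ?[X in _ + X]sum0 ?addr0;
  try by move=> i j; rewrite mxE ?XpE ?XmE mulr0.
rewrite summxE -[sigma0 z xi u a b](sum_delta (fun i j => sigma0 z xi u j i)) -sumrN.
apply: eq_bigr => i _; rewrite summxE -sumrN; apply: eq_bigr => j _.
by rewrite mxE X0E mulrN andbC.
Qed.

Lemma sigmaX_pos_neg a b : sigmaX z xi u s (pos a) (neg b) = sigmam z xi u s a b.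
Proof.
rewrite /sigmaX 2!mxE [X in X + _ + _]sum0 ?[X in _ + X]sum0 ?addr0 ?add0r;
  try by move=> i j; rewrite mxE ?X0E ?XmE mulr0.
rewrite summxE -[RHS]sum_lt_delta; first last.
- move=> i; rewrite /sigmam z_diag mulr0 add0r.
  rewrite big1 ?oppr0 // => k _; rewrite big1 // => l _; ring.
- exact: sigmam_skew.
apply: eq_bigr => i _; rewrite summxE; apply: eq_bigr => j _; by rewrite mxE XpE.
Qed.

Lemma sigmaX_neg_pos a b : sigmaX z xi u s (neg a) (pos b) = xi a b.
Proof.
rewrite /sigmaX 2!mxE [X in X + _ + _]sum0 ?[X in _ + X + _]sum0 ?addr0 ?add0r;
  try by move=> i j; rewrite mxE ?X0E ?XpE mulr0.
rewrite summxE -[RHS](sum_lt_delta (c := xi)) //.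
apply: eq_bigr => i _; rewrite summxE; apply: eq_bigr => j _.
by rewrite mxE XmE /sigmap mulrNN.
Qed.

End SymbolMatrix.

Section SymbolPfaffian.
Variables (K : numFieldType) (A : comAlgType K) (n : nat).
Variables (z xi : 'M[A]_n) (u : A) (s : int).
Hypotheses (z_skew : forall i j, z i j = - z j i) (z_diag : forall i, z i i = 0).
Hypotheses (xi_skew : forall i j, xi i j = - xi j i) (xi_diag : forall i, xi i i = 0).

Let w := u + \sum_(k < n) \sum_(l < n | (k < l)%N) z k l * xi k l.
Let J := antidiag_mx A n.

Lemma sigmaX_antidiag :
  sigmaX z xi u s *m antidiag_mx A (n + n) =
  block_mx (- (w + s%:~R) *: z - z *m xi *m z) ((w%:M + z *m xi) *m J)
           (- (J *m (w%:M + xi *m z))) (J *m xi *m J).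
Proof.
have zT : z^T = - z by apply/matrixP => a b; rewrite !mxE.
have xiT : xi^T = - xi by apply/matrixP => a b; rewrite !mxE.
apply/matrixP => a b; rewrite mulmx_antidiag.
case: (split_ordP a) => i ->; case: (split_ordP b) => j ->.
- by rewrite block_mxEul rev_ord_lshift sigmaX_pos_neg // sigmamE.
- rewrite block_mxEur rev_ord_rshift sigmaX_pos_pos sigma0E // mulmx_antidiag.
  rewrite -[_ + xi *m z]trmxK mxE linearD /= tr_scalar_mx trmx_mul zT xiT.
  by rewrite mulNmx mulmxN opprK.
- rewrite block_mxEdl rev_ord_lshift rshift_neg sigmaX_neg_neg sigma0E //.
  by rewrite [RHS]mxE antidiag_mulmx.
by rewrite block_mxEdr rev_ord_rshift rshift_neg sigmaX_neg_pos // mulmx_antidiag antidiag_mulmx.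
Qed.

(** Simultaneous row and column operations, with the rows of the lower half
    multiplied by - z J and added to the upper half. *)
Lemma Pf_sigmaX_reduced :
  antidiag_Pf (sigmaX z xi u s) =
  Pf (block_mx ((w - s%:~R) *: z) (w *: J) (- (w *: J)) (J *m xi *m J)).
Proof.
have zT : z^T = - z by apply/matrixP => a b; rewrite !mxE.
have JJ : J *m J = 1%:M by apply: antidiag_sqr.
pose G := block_mx 1%:M (- (z *m J)) 0 1%:M.
have dG : \det G = 1 by rewrite det_ublock !det1 mulr1.
rewrite /antidiag_Pf sigmaX_antidiag.
transitivity (\det G * Pf (block_mx (- (w + s%:~R) *: z - z *m xi *m z)
  ((w%:M + z *m xi) *m J) (- (J *m (w%:M + xi *m z))) (J *m xi *m J))).
  by rewrite dG mul1r.
rewrite -Pf_congruence; congr Pf.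
rewrite /G tr_block_mx !trmx1 trmx0 linearN /= trmx_mul [J^T]tr_antidiag zT.
rewrite !mulmx_block !(mul1mx, mulmx1, mul0mx, mulmx0, addr0, add0r).
have cancelJ m (N : 'M[A]_(n, m)) : J *m (J *m N) = N.
  by rewrite mulmxA JJ mul1mx.
have ur : (w%:M + z *m xi) *m J + - (z *m J) *m (J *m xi *m J) = w *: J.
  rewrite mulmxDl mul_scalar_mx mulNmx -!mulmxA cancelJ.
  by rewrite addrK.
rewrite ur [antidiag_mx _ _ *m - z]mulmxN opprK -/J; congr block_mx.
- rewrite -scalemxAl cancelJ mulmxN mulNmx opprK -[z *m J *m _]mulmxA cancelJ mulmxDr.
  rewrite mul_mx_scalar mulmxA [_ + (_ + z *m xi *m z)]addrC.
  rewrite addrA addrAC; apply/matrixP => i j; rewrite !mxE; ring.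
- by rewrite -!mulmxA cancelJ mulmxDr mul_mx_scalar opprD addrNK.
Qed.

Lemma Pf_princ_submx (i0 : 'I_n) (M : 'M[A]_n) (S : {set 'I_n}) :
  Pf_seq M (enum S) = Pf (princ_submx S M).
Proof.
rewrite (@Pf_seq_nth _ _ _ i0 #|S|) -?cardE //; congr Pf.
by apply/matrixP => i j; rewrite !mxE -!enum_val_nth.
Qed.

(** Enumerations of sets are increasing, so the two-element sets correspond to
    the pairs k < l, and the Pfaffian of a form along [:: k; l] is its entry. *)
Lemma gamma1 (i0 : 'I_n) :
  gamma z xi 1 = \sum_(k < n) \sum_(l < n | (k < l)%N) z k l * xi k l.
Proof.
have Pf2 (M : 'M[A]_n) k l : (forall i j, M i j = - M j i) ->
    Pf_seq M [:: k; l] = M k l.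
  by move=> Ms; rewrite Pf_seq_expand // big_ord1 Pf_seq_nil mul1r mulr1.
have enum2 (k l : 'I_n) : (k < l)%N -> enum [set k; l] = [:: k; l].
  move=> kl; apply: (@irr_sorted_eq _ (fun i j : 'I_n => (i < j)%N)).
  - by move=> i j k'; apply: ltn_trans.
  - by move=> i; rewrite /= ltnn.
  - rewrite [enum _]/(filter _ _) -enumT; apply: sorted_filter.
      by move=> i j k'; apply: ltn_trans.
    by have := iota_ltn_sorted 0 n; rewrite -val_enum_ord sorted_map.
  - by rewrite /= kl.
  by move=> i; rewrite mem_enum !inE.
rewrite pair_big_dep /gamma /=.
rewrite (reindex_onto (fun p : 'I_n * 'I_n => [set p.1; p.2])
   (fun S : {set 'I_n} => (nth i0 (enum S) 0%N, nth i0 (enum S) 1%N))) /=; last first.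
  move=> S /eqP cS; apply/setP => i; rewrite -[RHS]mem_enum !inE.
  move: cS; rewrite cardE.
  by case: (enum S) => [|a [|b []]] //= _; rewrite !inE.
rewrite (eq_bigl (fun p : 'I_n * 'I_n => (p.1 < p.2)%N)); last first.
  move=> [k l] /=; case: (ltngtP k l) => [kl|lk|/val_inj ->].
  - have kl' : (k == l) = false by rewrite -val_eqE ltn_eqF.
    by rewrite enum2 // cards2 kl' /= eqxx.
  - by rewrite setUC enum2 // xpair_eqE -val_eqE /= (ltn_eqF lk) andbF.
  by rewrite setUid cards1.
apply: eq_bigr => -[k l] /= kl.
by rewrite -!(Pf_princ_submx i0) enum2 // !Pf2.
Qed.


(** The second half of the index list is reversed because -i stands for the
    position 2n + 1 - i. *)
Lemma Pf_reduced_block (i0 : 'I_n) (c : A) :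
  Pf (block_mx (c *: z) (w *: J) (- (w *: J)) (J *m xi *m J)) =
  Pf_seq (block_form (c *: z) xi w setT)
    (map inl (enum 'I_n) ++ rev (map inr (enum 'I_n))).
Proof.
set L := _ ++ _.
have sL : size L = (n + n)%N.
  by rewrite size_cat size_rev (size_map inl) (size_map inr) size_enum_ord.
rewrite (@Pf_seq_nth _ _ _ (inl i0) _ _ _ sL); congr Pf.
have nthl (i : 'I_n) : nth (inl i0) L (lshift n i) = inl i.
  rewrite nth_cat (size_map inl) size_enum_ord /= ltn_ord (nth_map i0) ?size_enum_ord //.
  by rewrite nth_ord_enum.
have nthr (i : 'I_n) : nth (inl i0) L (rshift n i) = inr (rev_ord i).
  rewrite nth_cat (size_map inl) size_enum_ord /= ltnNge leq_addr /= addKn.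
  rewrite nth_rev (size_map inr) size_enum_ord // (nth_map i0) ?size_enum_ord; last first.
    by have := ltn_ord i; lia.
  by rewrite (nth_ord_enum i0 (rev_ord i)).
apply/matrixP => a b; rewrite [RHS]mxE.
case: (split_ordP a) => i ->; case: (split_ordP b) => j ->.
- by rewrite block_mxEul !nthl.
- rewrite block_mxEur nthl nthr /= in_setT andbT !mxE.
  have -> : (j == rev_ord i) = (i == rev_ord j).
    by rewrite -(inj_eq rev_ord_inj) rev_ordK eq_sym.
  by case: eqP; rewrite ?mulr1 ?mulr0.
- rewrite block_mxEdl nthl nthr /= in_setT andbT !mxE [_ == j]eq_sym.
  by case: eqP; rewrite ?mulr1 ?mulr0 ?oppr0.
by rewrite block_mxEdr !nthr mulmx_antidiag antidiag_mulmx.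
Qed.

Lemma Pf_sigmaX (i0 : 'I_n) :
  antidiag_Pf (sigmaX z xi u s) =
  \sum_(k < (n./2).+1)
    w ^+ (n - 2 * k) * (s%:~R - w) ^+ k * gamma z xi k.
Proof.
rewrite Pf_sigmaX_reduced (Pf_reduced_block i0) Pf_block_form //; last first.
  by move=> i j; rewrite !mxE z_skew mulrN.
rewrite card_ord; apply: eq_bigr => k _; rewrite -!mulrA; congr (_ * _).
rewrite /gamma !mulr_sumr; apply: eq_bigr => S /eqP cS.
rewrite !(Pf_princ_submx i0).
have -> : princ_submx S ((w - s%:~R) *: z) = (w - s%:~R) *: princ_submx S z.
  by apply/matrixP => i j; rewrite !mxE.
have -> : (s%:~R - w) ^+ k = (-1) ^+ k * (w - s%:~R) ^+ k.
  by rewrite -exprMn mulN1r opprB.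
have -> : val k = #|S|./2 by rewrite cS mul2n doubleK.
by rewrite Pf_scale !mulrA.
Qed.

End SymbolPfaffian.

(** * Specialisation to the indeterminates *)

Lemma alt_mx_skew (C : comNzRingType) n (f : upair n -> {mpoly C[#|indet n|]}) i j :
  alt_mx f i j = - alt_mx f j i.
Proof.
rewrite !mxE; case: insubP => [p /= ij _|nij]; case: insubP => [q /= ji _|nji];
  rewrite ?opprK ?oppr0 //.
by move: ij ji; lia.
Qed.

Lemma alt_mx_diag (C : comNzRingType) n (f : upair n -> {mpoly C[#|indet n|]}) i :
  alt_mx f i i = 0.
Proof. by rewrite mxE; case: insubP => //= p; rewrite ltnn. Qed.

Theorem corollary4p5 (R : realType) (n : nat) (hn : (1 <= n)%N) (s : int) :
  let z := zvar R[i] n in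
  let xi := xivar R[i] n in
  let u := uvar R[i] n in
  let g := gamma z xi in
  antidiag_Pf (sigmaX z xi u s) =
    \sum_(k < (n./2).+1)
      (u + g 1%N) ^+ (n - 2 * k) * (s%:~R - (u + g 1%N)) ^+ k * g k.
Proof.
move=> z xi u g.
have zs : forall i j, z i j = - z j i by move=> i j; apply: alt_mx_skew.
have xs : forall i j, xi i j = - xi j i by move=> i j; apply: alt_mx_skew.
have zd : forall i, z i i = 0 by move=> i; apply: alt_mx_diag.
have xd : forall i, xi i i = 0 by move=> i; apply: alt_mx_diag.
rewrite /g (gamma1 zs xs (Ordinal hn)).
exact: (Pf_sigmaX u s zs zd xs xd (Ordinal hn)).
Qed.
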